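(* Let $\rho:\Gamma_{\mathrm{cube}}\to\mathrm{Isom}(\mathbb A\mathrm d\mathbb S^4)$ be a representation whose image is a cusp group or a collapsed cusp group. Then for all representations $\rho'$ in some neighbourhood of $\rho$ in $\mathrm{Hom}(\Gamma_{\mathrm{cube}},\mathrm{Isom}(\mathbb A\mathrm d\mathbb S^4))$, exactly one of the following holds: (1) there are two distinct generators $s_1,s_2$ such that $\rho(s_1)=\rho(s_2)$ is a reflection in a spacelike hyperplane, and $\rho'(s_1)=\rho'(s_2)$; (2) the image of $\rho'$ is a cusp group.
   Context: Let $q_{-1}(x)=-x_0^2+x_1^2+x_2^2+x_3^2-x_4^2$ on $\mathbb R^5$ with bilinear form $b_{-1}$. $\mathbb A\mathrm d\mathbb S^4=\{q_{-1}=-1\}$, $\mathrm{Isom}(\mathbb A\mathrm d\mathbb S^4)=\mathrm O(q_{-1})$, and $\partial\mathbb A\mathrm d\mathbb S^4=\{x\ne0: q_{-1}(x)=0\}/\mathbb R_{>0}$, both viewed in the projective sphere $(\mathbb R^5\smallsetminus\{0\})/\mathbb R_{>0}$. A hyperplane is the intersection of $\mathbb A\mathrm d\mathbb S^4$ with a linear hyperplane $X^\perp$ of $\mathbb R^5$ ($\perp$ with respect to $b_{-1}$); it is spacelike if $q_{-1}(X)<0$ and timelike if $q_{-1}(X)>0$; it is asymptotic to a point $p\in\partial\mathbb A\mathrm d\mathbb S^4$ if $p$ lies in its closure in the projective sphere. A reflection is a non-trivial involution in $\mathrm{Isom}(\mathbb A\mathrm d\mathbb S^4)$ fixing a hyperplane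 pointwise; it is $r_X$ for some $X$ with $q_{-1}(X)=\pm1$, where $r_X$ is $-1$ on $X$ and the identity on $X^\perp$. $\Gamma_{\mathrm{cube}}$ is the right-angled Coxeter group generated by the reflections in the faces of a Euclidean cube: six generators of order two, one per face; generators of adjacent faces commute ($12$ relations); no relation between opposite faces. The image of a representation $\Gamma_{\mathrm{cube}}\to\mathrm{Isom}(\mathbb A\mathrm d\mathbb S^4)$ is called: - a cusp group if the six generators are sent to reflections in six distinct hyperplanes asymptotic to a common point at infinity; - a collapsed cusp group if the six generators are sent to reflections along five distinct hyperplanes asymptotic to a common point at infinity, and the unique reflection associated to two generators is along a spacelike hyperplane. *)

(* Defs.v *)
From HB Require Import structures.
From mathcomp Require Import all_boot all_order all_algebra.
From mathcomp Require Import all_classical all_reals all_analysis.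

Set Implicit Arguments.
Unset Strict Implicit.
Unset Printing Implicit Defensive.

Import Order.TTheory GRing.Theory Num.Theory.
Import numFieldNormedType.Exports.
Local Open Scope classical_set_scope.
Local Open Scope quotient_scope.
Local Open Scope ring_scope.

(* The face (i, e) of the cube [-1, 1]^3 is the one orthogonal to the i-th     *)
(* axis, on the side given by the sign e.                                      *)
Definition cube_face : Type := 'I_3 * bool.

Definition adjacent_faces (s t : cube_face) : bool := s.1 != t.1.

(* The congruence on words in the generators spanned by the defining           *)
(* relations. Generators are involutions, so positive words suffice: the       *)
(* inverse of a word is its reversal.                                          *)
Inductive cube_congr : seq cube_face -> seq cube_face -> Prop :=
| CubeRefl u : cube_congr u u
| CubeSym u v : cube_congr u v -> cube_congr v u
| CubeTrans u v w : cube_congr u v -> cube_congr v w -> cube_congr u w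
| CubeInvol u v s : cube_congr (u ++ [:: s; s] ++ v) (u ++ v)
| CubeComm u v s t : adjacent_faces s t ->
    cube_congr (u ++ [:: s; t] ++ v) (u ++ [:: t; s] ++ v).

Definition cube_congrb : rel (seq cube_face) := fun u v => `[< cube_congr u v >].

Lemma cube_congrb_refl : reflexive cube_congrb.
Proof. by move=> u; apply/asboolP; exact: CubeRefl. Qed.

Lemma cube_congrb_sym : symmetric cube_congrb.
Proof. by move=> u v; apply/asboolP/asboolP; exact: CubeSym. Qed.

Lemma cube_congrb_trans : transitive cube_congrb.
Proof.
by move=> v u w /asboolP uv /asboolP vw; apply/asboolP; exact: CubeTrans uv vw.
Qed.

Canonical cube_equiv :=
  EquivRel cube_congrb cube_congrb_refl cube_congrb_sym cube_congrb_trans.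

Definition cube_group : Type := {eq_quot cube_equiv}.

HB.instance Definition _ := Choice.on cube_group.
HB.instance Definition _ := EqQuotient.on cube_group.

Definition cube_gen (s : cube_face) : cube_group := \pi_cube_group [:: s].

Lemma cube_congr_catl w u v : cube_congr u v -> cube_congr (w ++ u) (w ++ v).
Proof.
elim=> [a|a b _|a b c _ + _|a b s|a b s t st].
- exact: CubeRefl.
- exact: CubeSym.
- exact: CubeTrans.
- by rewrite !catA -(catA _ [:: s; s]); exact: CubeInvol.
- by rewrite !catA -2!(catA (w ++ a)); exact: CubeComm.
Qed.

Lemma cube_congr_catr w u v : cube_congr u v -> cube_congr (u ++ w) (v ++ w).
Proof.
elim=> [a|a b _|a b c _ + _|a b s|a b s t st].
- exact: CubeRefl.
- exact: CubeSym.
- exact: CubeTrans.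
- by rewrite -!catA; exact: CubeInvol.
- by rewrite -!catA; exact: CubeComm.
Qed.

Lemma cube_congr_rev u v : cube_congr u v -> cube_congr (rev u) (rev v).
Proof.
elim=> [a|a b _|a b c _ + _|a b s|a b s t st].
- exact: CubeRefl.
- exact: CubeSym.
- exact: CubeTrans.
- by rewrite !rev_cat -catA; exact: CubeInvol.
- by rewrite !rev_cat -!catA; apply: CubeComm; rewrite /adjacent_faces eq_sym.
Qed.

Lemma cube_piP u v :
  reflect (cube_congr u v) (\pi_cube_group u == \pi_cube_group v).
Proof. by rewrite (eqmodE cube_equiv); exact: asboolP. Qed.

Lemma cube_congr_repr u : cube_congr (repr (\pi_cube_group u)) u.
Proof. by apply/cube_piP; rewrite reprK. Qed.

Definition cube_mul (g h : cube_group) : cube_group :=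
  \pi_cube_group (repr g ++ repr h).
Definition cube_one : cube_group := \pi_cube_group [::].
Definition cube_inv (g : cube_group) : cube_group :=
  \pi_cube_group (rev (repr g)).

Lemma cube_mul_pi u v :
  cube_mul (\pi_cube_group u) (\pi_cube_group v) = \pi_cube_group (u ++ v).
Proof.
apply/eqP/cube_piP; apply: CubeTrans (cube_congr_catl _ (cube_congr_repr v)).
exact/cube_congr_catr/cube_congr_repr.
Qed.

Lemma cube_inv_pi u : cube_inv (\pi_cube_group u) = \pi_cube_group (rev u).
Proof. by apply/eqP/cube_piP/cube_congr_rev/cube_congr_repr. Qed.

Lemma cube_congr_revl u : cube_congr (rev u ++ u) [::].
Proof.
elim: u => [|s u IHu]; first exact: CubeRefl.
apply: CubeTrans IHu; rewrite rev_cons cat_rcons.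
exact: (CubeInvol (rev u) u s).
Qed.

Lemma cube_group_ind (P : cube_group -> Prop) :
  (forall u, P (\pi_cube_group u)) -> forall g, P g.
Proof. by move=> piP g; rewrite -[g]reprK. Qed.

Lemma cube_mulA : associative cube_mul.
Proof.
elim/cube_group_ind=> u; elim/cube_group_ind=> v; elim/cube_group_ind=> w.
by rewrite !cube_mul_pi catA.
Qed.

Lemma cube_mul1g : left_id cube_one cube_mul.
Proof. by elim/cube_group_ind=> u; rewrite cube_mul_pi. Qed.

Lemma cube_mulg1 : right_id cube_one cube_mul.
Proof. by elim/cube_group_ind=> u; rewrite cube_mul_pi cats0. Qed.

Lemma cube_mulVg : left_inverse cube_one cube_inv cube_mul.
Proof.
elim/cube_group_ind=> u; rewrite cube_inv_pi cube_mul_pi.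
exact/eqP/cube_piP/cube_congr_revl.
Qed.

Lemma cube_mulgV : right_inverse cube_one cube_inv cube_mul.
Proof.
elim/cube_group_ind=> u; rewrite cube_inv_pi cube_mul_pi.
by apply/eqP/cube_piP; have := cube_congr_revl (rev u); rewrite revK.
Qed.

HB.instance Definition _ :=
  isGroup.Build cube_group cube_mulA cube_mul1g cube_mulg1 cube_mulVg cube_mulgV.

Section AdS.
Variable R : realType.

Definition qform (x : 'cV[R]_5) : R :=
  - x (inord 0) 0 ^+ 2 + x (inord 1) 0 ^+ 2 + x (inord 2) 0 ^+ 2
  + x (inord 3) 0 ^+ 2 - x (inord 4) 0 ^+ 2.

Definition bform (x y : 'cV[R]_5) : R :=
  - (x (inord 0) 0 * y (inord 0) 0) + x (inord 1) 0 * y (inord 1) 0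
  + x (inord 2) 0 * y (inord 2) 0 + x (inord 3) 0 * y (inord 3) 0
  - x (inord 4) 0 * y (inord 4) 0.

Definition AdS : set 'cV[R]_5 := [set x | qform x = -1].

(* Isom(AdS^4) = O(q), acting on column vectors by x |-> A *m x. *)
Definition isom_set : set 'M[R]_5 :=
  [set A | A \in unitmx /\ forall x, qform (A *m x) = qform x].

Definition isom_ads : Type := set_type isom_set.

HB.instance Definition _ := SubType.on isom_ads.
HB.instance Definition _ := Choice.on isom_ads.
HB.instance Definition _ := Topological.copy isom_ads (set_type isom_set).

Implicit Types A B : isom_ads.

Lemma isom_unit A : val A \in unitmx.
Proof. by have /set_mem[] := valP A. Qed.

Lemma isom_qform A x : qform (val A *m x) = qform x.
Proof. by have /set_mem[_] := valP A. Qed.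

Lemma isom_mul_subproof A B : val A *m val B \in isom_set.
Proof.
apply/mem_set; split=> [|x]; first by rewrite unitmx_mul !isom_unit.
by rewrite -mulmxA !isom_qform.
Qed.

Lemma isom_one_subproof : 1%:M \in isom_set.
Proof. by apply/mem_set; split=> [|x]; rewrite ?unitmx1 ?mul1mx. Qed.

Lemma isom_inv_subproof A : invmx (val A) \in isom_set.
Proof.
apply/mem_set; split=> [|x]; first by rewrite unitmx_inv isom_unit.
by rewrite -[LHS](isom_qform A) mulKVmx ?isom_unit.
Qed.

Definition isom_mul A B : isom_ads := Sub (val A *m val B) (isom_mul_subproof A B).
Definition isom_one : isom_ads := Sub 1%:M isom_one_subproof.
Definition isom_inv A : isom_ads := Sub (invmx (val A)) (isom_inv_subproof A).

Lemma isom_mulA : associative isom_mul.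
Proof. by move=> A B C; apply: val_inj; rewrite !SubK mulmxA. Qed.

Lemma isom_mul1g : left_id isom_one isom_mul.
Proof. by move=> A; apply: val_inj; rewrite !SubK mul1mx. Qed.

Lemma isom_mulg1 : right_id isom_one isom_mul.
Proof. by move=> A; apply: val_inj; rewrite !SubK mulmx1. Qed.

Lemma isom_mulVg : left_inverse isom_one isom_inv isom_mul.
Proof. by move=> A; apply: val_inj; rewrite !SubK mulVmx ?isom_unit. Qed.

Lemma isom_mulgV : right_inverse isom_one isom_inv isom_mul.
Proof. by move=> A; apply: val_inj; rewrite !SubK mulmxV ?isom_unit. Qed.

HB.instance Definition _ :=
  isGroup.Build isom_ads isom_mulA isom_mul1g isom_mulg1 isom_mulVg isom_mulgV.

(* The projective sphere (R^5 \ {0}) / R_{>0}, with the quotient topology. *)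
Definition nonzero_vec : set 'cV[R]_5 := [set x | x != 0].

Definition same_ray : rel nonzero_vec :=
  fun x y => `[< exists2 c : R, 0 < c & val y = c *: val x >].

Lemma same_ray_refl : reflexive same_ray.
Proof. by move=> x; apply/asboolP; exists 1; rewrite ?ltr01 ?scale1r. Qed.

Lemma same_ray_sym : symmetric same_ray.
Proof.
suff H x y : same_ray x y -> same_ray y x by move=> x y; apply/idP/idP; exact: H.
move=> /asboolP[c c0 yx]; apply/asboolP; exists c^-1; first by rewrite invr_gt0.
by rewrite yx scalerA mulVf ?scale1r ?gt_eqF.
Qed.

Lemma same_ray_trans : transitive same_ray.
Proof.
move=> y x z /asboolP[c c0 yx] /asboolP[d d0 zy]; apply/asboolP.
by exists (d * c); [exact: mulr_gt0|rewrite zy yx scalerA].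
Qed.

Canonical ray_equiv :=
  EquivRel same_ray same_ray_refl same_ray_sym same_ray_trans.

Definition proj_sphere : Type := quotient_topology {eq_quot ray_equiv}.

HB.instance Definition _ := Topological.on proj_sphere.
HB.instance Definition _ := Quotient.on proj_sphere.

Definition ray (x : nonzero_vec) : proj_sphere := \pi_proj_sphere x.

Definition bdry_AdS : set proj_sphere :=
  [set ray x | x in [set x : nonzero_vec | qform (val x) = 0]].

Definition in_sphere (H : set 'cV[R]_5) : set proj_sphere :=
  [set ray x | x in [set x : nonzero_vec | H (val x)]].

Definition hyperplane (X : 'cV[R]_5) : set 'cV[R]_5 :=
  AdS `&` [set x | bform X x = 0].

Definition is_hyperplane (H : set 'cV[R]_5) : Prop :=
  exists2 X, X != 0 & H = hyperplane X.

Definition spacelike (H : set 'cV[R]_5) : Prop :=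
  exists2 X, qform X < 0 & H = hyperplane X.

Definition asymptotic (H : set 'cV[R]_5) (p : proj_sphere) : Prop :=
  closure (in_sphere H) p.

Definition reflection_in (A : isom_ads) (H : set 'cV[R]_5) : Prop :=
  [/\ is_hyperplane H, A <> 1%g, (A * A)%g = 1%g
    & forall x, H x -> val A *m x = x].

(* Hom(Gamma_cube, Isom(AdS^4)) with the topology of pointwise convergence,    *)
(* i.e. the topology induced from Isom(AdS^4)^6 by evaluation on the six       *)
(* generators.                                                                 *)
Definition cube_hom : set {ptws cube_group -> isom_ads} :=
  [set rho | forall g h, rho (g * h)%g = (rho g * rho h)%g].

Definition on_gen (rho : cube_hom) (s : cube_face) : isom_ads :=
  (val rho : cube_group -> isom_ads) (cube_gen s).

Definition cusp_group (rho : cube_hom) : Prop :=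
  exists (H : cube_face -> set 'cV[R]_5) (p : proj_sphere),
    [/\ bdry_AdS p, injective H
      & forall s, reflection_in (on_gen rho s) (H s) /\ asymptotic (H s) p].

Definition collapsed_cusp_group (rho : cube_hom) : Prop :=
  exists (H : cube_face -> set 'cV[R]_5) (p : proj_sphere),
    [/\ bdry_AdS p,
        forall s, reflection_in (on_gen rho s) (H s) /\ asymptotic (H s) p
      & exists s1 s2 : cube_face,
          [/\ s1 != s2, H s1 = H s2, spacelike (H s1)
            & {in predC1 s2 &, injective H}]].

End AdS.

Arguments AdS : clear implicits.
Arguments isom_set : clear implicits.
Arguments nonzero_vec : clear implicits.
Arguments bdry_AdS : clear implicits.
Arguments cube_hom : clear implicits.

(* Main.v *)
(* A reflection is an involution of trace 3, so every representation near rho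
   sends generators to involutions whose trace is close to 3, that is, to
   reflections r_(Y s); moreover generators with distinct images under rho keep
   distinct images. Hence, if (1) fails, the six reflections are distinct, and
   commutation of adjacent faces makes Y s and Y t orthogonal.
   For each pair of opposite faces let w_i <> 0 be the component of one normal
   vector orthogonal to the other one. The normals Y_0, Y_1, Y_2 and w_0, w_1,
   w_2 are pairwise orthogonal. Were w_0 non-null, the orthogonal complement of
   Y_0, Y_1, Y_2, w_0 in R^5 would be a non-degenerate line, with no room for
   both w_1 and w_2. So w_0 is null; it is orthogonal to all six normals and
   spans the common point at infinity. *)
Require Import Defs.
From mathcomp Require Import all_boot all_order all_algebra.
From mathcomp Require Import ring lra.
From mathcomp Require Import all_classical all_reals all_analysis.

Set Implicit Arguments.
Unset Strict Implicit.
Unset Printing Implicit Defensive.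

Import Order.TTheory GRing.Theory Num.Theory.
Import numFieldNormedType.Exports.
Local Open Scope classical_set_scope.
Local Open Scope ring_scope.

(** * The ambient form: non-degeneracy, negative vectors, isometries *)

Section BilinearForm.
Variable R : realType.
Implicit Types (x y z u X Y : 'cV[R]_5) (a : R).

Lemma qformE x : qform x = bform x x.
Proof. by rewrite /qform /bform !expr2. Qed.

Lemma bformC x y : bform x y = bform y x.
Proof. by rewrite /bform; ring. Qed.

Lemma bformDr x y z : bform x (y + z) = bform x y + bform x z.
Proof. by rewrite /bform !mxE; ring. Qed.

Lemma bformZr x a y : bform x (a *: y) = a * bform x y.
Proof. by rewrite /bform !mxE; ring. Qed.

Lemma bformNr x y : bform x (- y) = - bform x y.
Proof. by rewrite -scaleN1r bformZr mulN1r. Qed.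

Lemma bformBr x y z : bform x (y - z) = bform x y - bform x z.
Proof. by rewrite bformDr bformNr. Qed.

Lemma bformBl x y z : bform (x - y) z = bform x z - bform y z.
Proof. by rewrite bformC bformBr !(bformC z). Qed.

Lemma bformZl a x y : bform (a *: x) y = a * bform x y.
Proof. by rewrite bformC bformZr bformC. Qed.

Lemma bform0r x : bform x 0 = 0.
Proof. by rewrite -(scale0r x) bformZr mul0r. Qed.

Lemma bform0l x : bform 0 x = 0.
Proof. by rewrite bformC bform0r. Qed.

Lemma bform_sumr x (c : 'I_5 -> R) (v : 'I_5 -> 'cV[R]_5) :
  bform x (\sum_i c i *: v i) = \sum_i c i * bform x (v i).
Proof.
rewrite (big_morph (bform x) (bformDr x) (bform0r x)).
by apply: eq_bigr => i _; rewrite bformZr.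
Qed.

Lemma qformD x y : qform (x + y) = qform x + bform x y *+ 2 + qform y.
Proof. by rewrite !qformE /bform !mxE; ring. Qed.

Lemma qformZ a x : qform (a *: x) = a ^+ 2 * qform x.
Proof. by rewrite !qformE bformZr bformZl mulrA. Qed.

(** The Gram matrix of [bform] in the standard basis. *)
Definition sign_mx : 'M[R]_5 :=
  diag_mx (\row_i (if (i == inord 0) || (i == inord 4) then -1 else 1)).

Lemma sign_mxK : sign_mx *m sign_mx = 1%:M.
Proof.
rewrite mulmx_diag -diag_const_mx; congr diag_mx; apply/rowP => i; rewrite !mxE.
by case: ifP => _; rewrite ?mulrNN mulr1.
Qed.

Lemma bform_mx x y : bform x y = (x^T *m sign_mx *m y) 0 0.
Proof.
rewrite mul_mx_diag mxE !big_ord_recl big_ord0 /bform.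
have liftE : [/\ lift ord0 ord0 = inord 1 :> 'I_5,
  lift ord0 (lift ord0 ord0) = inord 2 :> 'I_5,
  lift ord0 (lift ord0 (lift ord0 ord0)) = inord 3 :> 'I_5
  & lift ord0 (lift ord0 (lift ord0 (lift ord0 ord0))) = inord 4 :> 'I_5].
  by split; apply: val_inj; rewrite /= inordK.
case: liftE => -> -> -> ->.
have -> : ord0 = inord 0 :> 'I_5 by apply: val_inj; rewrite /= inordK.
by rewrite !mxE -!val_eqE /= !inordK //=; ring.
Qed.

Lemma bform_nondegenerate u : (forall y, bform u y = 0) -> u = 0.
Proof.
move=> u0; have {}u0 : u^T *m sign_mx = 0.
  apply/rowP => j; have := u0 (delta_mx j 0).
  by rewrite bform_mx -colE mxE => ->; rewrite mxE.
by apply: trmx_inj; rewrite -[u^T]mulmx1 -sign_mxK mulmxA u0 mul0mx trmx0.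
Qed.

Lemma bform_eq1 X : X != 0 -> exists z, bform X z = 1.
Proof.
move=> /eqP X0; have [y Xy] : exists y, bform X y != 0.
  apply: contrapT => /forallNP X0'; apply/X0/bform_nondegenerate => y.
  by apply/eqP/negPn/negP/X0'.
by exists ((bform X y)^-1 *: y); rewrite bformZr mulVf.
Qed.

(** Coordinates 0 and 4 span a negative definite plane, which every linear hyperplane meets in at
    least a line. Hence no hyperplane of [AdS] is empty. *)
Lemma hyperplane_negative X : exists2 y, bform X y = 0 & qform y = -1.
Proof.
suff [y Xy qy] : exists2 y, bform X y = 0 & qform y < 0.
  exists ((Num.sqrt (- qform y))^-1 *: y); first by rewrite bformZr Xy mulr0.
  rewrite qformZ exprVn sqr_sqrtr ?oppr_ge0 ?ltW //.
  by rewrite invrN mulNr mulVf // lt_eqF.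
pose vec a b : 'cV[R]_5 :=
  a *: delta_mx (inord 0) 0 + b *: delta_mx (inord 4) 0.
have bvec a b : bform X (vec a b)
    = - (X (inord 0) 0 * a) - X (inord 4) 0 * b.
  by rewrite /bform !mxE -!val_eqE /= !inordK //=; ring.
have qvec a b : qform (vec a b) = - a ^+ 2 - b ^+ 2.
  by rewrite /qform !mxE -!val_eqE /= !inordK //=; ring.
have [X00|X00] := eqVneq (X (inord 0) 0) 0.
  by exists (vec 1 0); rewrite ?bvec ?qvec ?X00; lra.
exists (vec (X (inord 4) 0) (- X (inord 0) 0)); first by rewrite bvec; ring.
have : 0 < X (inord 0) 0 ^+ 2 by rewrite exprn_even_gt0.
by rewrite qvec; have := sqr_ge0 (X (inord 4) 0); nra.
Qed.

Lemma isom_bform (A : isom_ads R) x y :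
  bform (val A *m x) (val A *m y) = bform x y.
Proof.
have := isom_qform A (x + y); rewrite mulmxDr !qformD !isom_qform.
by set a := bform _ _; set b := bform x y; lra.
Qed.

Lemma isom_involution_adjoint (A : isom_ads R) x y : (A * A)%g = 1%g ->
  bform (val A *m x) y = bform x (val A *m y).
Proof.
move=> /(congr1 val)/= AA; rewrite -[in LHS](mul1mx y) -AA.
by rewrite -mulmxA isom_bform.
Qed.

End BilinearForm.

(** * Reflections: explicit formula, uniqueness, commutation, detection by the trace *)

Section Reflections.
Variable R : realType.
Implicit Types (x y z u X Y : 'cV[R]_5) (M : 'M[R]_5) (A B : isom_ads R).

(** The formula of $r_X$ for a normal of any non-zero norm; leaving [X] unnormalised lets normals be
    rescaled freely. *)
Definition reflects M X : Prop :=
  qform X != 0 /\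
  forall x, M *m x = x - (2 * bform X x / qform X) *: X.

Lemma qform_neq0 X : qform X != 0 -> X != 0.
Proof. by apply: contraNneq => ->; rewrite qformE bform0l. Qed.

Lemma mulmx_cV_inj M N : (forall x, M *m x = N *m x) -> M = N.
Proof.
move=> MN; apply/matrixP => i j.
have := congr1 (fun z : 'cV_5 => z i 0) (MN (delta_mx j 0)).
by rewrite -!colE !mxE.
Qed.

Lemma reflects_self M X : reflects M X -> M *m X = - X.
Proof.
move=> [qX ME].
by rewrite ME -qformE mulfK // scaler_nat mulr2n opprD addrA subrr sub0r.
Qed.

Lemma reflects_fixed M X x : reflects M X -> (M *m x == x) = (bform X x == 0).
Proof.
move=> [qX ->]; rewrite -subr_eq0 addrC addKr oppr_eq0 scaler_eq0.
rewrite (negPf (qform_neq0 qX)) orbF !mulf_eq0 invr_eq0 (negPf qX).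
by rewrite pnatr_eq0 orbF.
Qed.

(** The formula is homogeneous of degree zero in the normal, so only the line it spans matters. *)
Lemma reflects_inj M N X Y : reflects M X -> reflects N Y ->
  (exists c, X = c *: Y) -> M = N.
Proof.
move=> [qX ME] [qY NE] [c XY]; apply: mulmx_cV_inj => x; rewrite ME NE.
move: qX; rewrite XY qformZ mulf_eq0 expf_eq0 /= => /norP[c0 _].
rewrite bformZl scalerA; congr (_ - _ *: _); field.
by rewrite c0 qY.
Qed.

(** The trace is $5-2$: the rank-one part $2XX^TJ/q(X)$, with $J$ the matrix [sign_mx], has trace 2
    by cyclicity. *)
Lemma reflects_trace M X : reflects M X -> \tr M = 3.
Proof.
move=> [qX ME].
suff -> : M = 1%:M - (2 / qform X) *: (X *m (X^T *m sign_mx R)).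
  rewrite linearB linearZ /= mxtrace1 mxtrace_mulC /mxtrace big_ord1.
  by rewrite -bform_mx -qformE divfK //; lra.
apply: mulmx_cV_inj => x; rewrite ME mulmxBl mul1mx -scalemxAl -mulmxA.
rewrite (mx11_scalar (X^T *m _ *m x)) -bform_mx mul_mx_scalar scalerA.
by congr (_ - _ *: _); rewrite mulrAC.
Qed.

Lemma reflects_reflection A X :
  reflects (val A) X -> reflection_in A (hyperplane X).
Proof.
move=> AX; have [qX AE] := AX; have X0 := qform_neq0 qX; split.
- by exists X.
- move=> A1; have := reflects_fixed X AX.
  by rewrite A1 mul1mx eqxx -qformE (negPf qX).
- apply/val_inj/mulmx_cV_inj => x.
  rewrite mul1mx -mulmxA (AE x) mulmxBr -scalemxAr.
  by rewrite (reflects_self AX) AE scalerN opprK subrK.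
- by move=> x [_ Xx]; apply/eqP; rewrite (reflects_fixed _ AX) Xx.
Qed.

(** Negative vectors of $X^\perp$ rescale into [AdS], and every vector of $X^\perp$ is a difference
    of two negative ones. *)
Lemma fixes_orthogonal M X : (forall x, hyperplane X x -> M *m x = x) ->
  forall x, bform X x = 0 -> M *m x = x.
Proof.
move=> fixM; have fixneg y : bform X y = 0 -> qform y < 0 -> M *m y = y.
  move=> Xy qy; have r0 : Num.sqrt (- qform y) != 0.
    by rewrite gt_eqF // sqrtr_gt0 oppr_gt0.
  have /(congr1 (fun z => Num.sqrt (- qform y) *: z)) :
      M *m ((Num.sqrt (- qform y))^-1 *: y) = (Num.sqrt (- qform y))^-1 *: y.
    apply: fixM; split; rewrite /AdS/= ?bformZr ?Xy ?mulr0 //.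
    rewrite qformZ exprVn sqr_sqrtr ?oppr_ge0 ?ltW //.
    by rewrite invrN mulNr mulVf // lt_eqF.
  by rewrite -scalemxAr !scalerA divff // !scale1r.
move=> x Xx; have [y Xy qy] := hyperplane_negative X.
(* Large enough that $q(ty+x)=-t^2+2t\,b(y,x)+q(x)$ is negative. *)
pose t := 2 * `|bform y x| + `|qform x| + 1.
have -> : x = (t *: y + x) - t *: y by rewrite addrAC subrr add0r.
have t1 : 1 <= t by rewrite lerDr addr_ge0 ?mulr_ge0.
rewrite mulmxBr fixneg ?bformDr ?bformZr ?Xy ?Xx ?mulr0 ?addr0 //; last first.
  rewrite qformD qformZ bformZl qy.
  have := ler_norm (bform y x); have := ler_norm (qform x).
  have := normr_ge0 (bform y x); have := normr_ge0 (qform x).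
  rewrite /t in t1 *; set a := bform y x; set b := qform x.
  by move: `|a| `|b| => p q; nra.
by rewrite -scalemxAr fixneg // qy ltrN10.
Qed.

(** Fixing $X^\perp$ gives $A=1-b(X,\cdot)u$. Self-adjointness puts $u$ on the line of $X$, and
    $A^2=1$ with $u\ne0$ forces $b(X,u)=2$, so $X$ cannot be null. *)
Lemma involution_reflects A X : X != 0 -> A <> 1%g -> (A * A)%g = 1%g ->
  (forall x, bform X x = 0 -> val A *m x = x) -> reflects (val A) X.
Proof.
move=> X0 A1 AA fixA; have [z Xz] := bform_eq1 X0.
pose u := z - val A *m z.
have AE x : val A *m x = x - bform X x *: u.
  have : val A *m (x - bform X x *: z) = x - bform X x *: z.
    by apply: fixA; rewrite bformBr bformZr Xz mulr1 subrr.
  rewrite mulmxBr -scalemxAr => /(canRL (subrK _)) ->.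
  by rewrite scalerBr opprB -addrA (addrC (- _)).
(* Expanding $b(Az,y)=b(z,Ay)$ leaves $b(u,y)=b(X,y)\,b(z,u)$ for all $y$. *)
have uE : u = bform z u *: X.
  apply/eqP; rewrite -subr_eq0; apply/eqP/bform_nondegenerate => y.
  have := isom_involution_adjoint z y AA.
  rewrite !AE Xz scale1r bformBl bformBr bformZr => /addrI/oppr_inj uy.
  by rewrite bformBl bformZl uy mulrC subrr.
have u0 : u != 0.
  apply/eqP => u0; apply: A1; apply/val_inj/mulmx_cV_inj => x.
  by rewrite AE u0 scaler0 subr0 mul1mx.
(* $A(Az)=z$ reads $(b(X,u)-2)u=0$. *)
have Xu : bform X u = 2.
  have AA1 : val A *m val A = 1%:M := congr1 val AA.
  have : val A *m (val A *m z) = z by rewrite mulmxA AA1 mul1mx.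
  rewrite [val A *m z]AE Xz scale1r mulmxBr !AE Xz scale1r.
  rewrite -[RHS]addr0 -addrA => /addrI/eqP.
  rewrite -opprD oppr_eq0 addrA -mulr2n -scaler_nat -scalerBl scaler_eq0.
  by rewrite (negPf u0) orbF subr_eq0 => /eqP.
move: Xu; rewrite uE bformZr -qformE => Xu.
have qX : qform X != 0.
  apply/eqP => qX; move: Xu; rewrite qX mulr0; apply/eqP.
  by rewrite eq_sym pnatr_eq0.
by split=> // x; rewrite AE uE scalerA -Xu; congr (_ - _ *: _); field.
Qed.

Lemma reflection_in_reflects A X : X != 0 ->
  reflection_in A (hyperplane X) -> reflects (val A) X.
Proof.
by move=> X0 [_ A1 AA /fixes_orthogonal fixA]; exact: involution_reflects.
Qed.

Lemma reflection_in_inj A B H : reflection_in A H -> reflection_in B H -> A = B.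
Proof.
move=> AH BH; have [[X X0 HX] _ _ _] := AH; rewrite HX in AH BH.
apply/val_inj/(@reflects_inj _ _ X X); try exact: reflection_in_reflects.
by exists 1; rewrite scale1r.
Qed.

(** By [reflects_fixed], the hyperplane of a reflection is exactly its set of fixed points in
    [AdS]. *)
Lemma reflection_in_hyperplane A H H' :
  reflection_in A H -> reflection_in A H' -> H = H'.
Proof.
move=> AH AH'; have [[X X0 HX] _ _ _] := AH; have [[Y Y0 HY] _ _ _] := AH'.
rewrite HX HY in AH AH' *.
have AX := reflection_in_reflects X0 AH.
have AY := reflection_in_reflects Y0 AH'.
by apply/seteqP; split=> x [? /eqP xH]; split=> //; apply/eqP; move: xH;
  rewrite -(reflects_fixed _ AX) -(reflects_fixed _ AY).
Qed.

(** $BX$ lies in the $(-1)$-eigenspace of $A$, as $X$ does. If $b(X,Y)\ne0$, their difference is a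
    non-zero multiple of $Y$, so $AY=-Y$; then $Y$ is on the line of $X$ and $A=B$. *)
Lemma reflects_commute A B X Y : reflects (val A) X -> reflects (val B) Y ->
  (A * B)%g = (B * A)%g -> A <> B -> bform X Y = 0.
Proof.
move=> AX BY AB neqAB; apply/eqP/negPn/negP => XY; apply: neqAB.
have [[qX AE] [qY BE]] := (AX, BY).
have AB' : val A *m val B = val B *m val A := congr1 val AB.
have : val A *m (val B *m X) = - (val B *m X).
  by rewrite mulmxA AB' -mulmxA (reflects_self AX) mulmxN.
rewrite (BE X) mulmxBr (reflects_self AX) -scalemxAr opprB.
rewrite [RHS]addrC => /addrI/eqP; rewrite -scalerN => /eqP.
have a0 : 2 * bform Y X / qform Y != 0.
  by rewrite !mulf_neq0 ?invr_neq0 ?pnatr_eq0 // bformC.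
move=> /(scalerI a0); rewrite AE opprB => /(canRL (subrK _)) XE.
apply/val_inj/(reflects_inj AX BY); exists (qform X / bform X Y).
apply: (scalerI (a := 2 * bform X Y / qform X)).
  by rewrite !mulf_neq0 ?invr_neq0 ?pnatr_eq0.
rewrite XE scalerA -mulr2n -scaler_nat; congr (_ *: _); field.
by rewrite XY qX.
Qed.

(** In a full-rank factorisation $P=cr$, one-sided inverses cancel $crcr=cr$ down to $rc=1$, an
    identity matrix whose size is the rank. *)
Lemma mxtrace_idempotent (F : fieldType) n (P : 'M[F]_n) :
  P *m P = P -> \tr P = (\rank P)%:R.
Proof.
move=> PP; rewrite -{1}(mulmx_base P) mxtrace_mulC.
suff -> : row_base P *m col_base P = 1%:M by rewrite mxtrace1.
have PE := mulmx_base P; have /row_freeP[r' rr'] := row_base_free P.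
have /row_fullP[l' l'l] := col_base_full P.
move: (col_base P) (row_base P) l'l rr' PE => c r l'l rr' PE.
have : l' *m (c *m r *m (c *m r)) *m r' = l' *m (c *m r) *m r'.
  by rewrite PE PP.
rewrite !mulmxA l'l !mul1mx rr'.
by rewrite -(mulmxA _ _ r') rr' mulmx1.
Qed.

(* (1 - A) / 2 is idempotent, so its trace is its rank, here 1. *)
Lemma involution_near_reflection A : (A * A)%g = 1%g ->
  `|\tr (val A) - 3| < 1 -> exists X, reflects (val A) X.
Proof.
move=> AA trA; have AA1 : val A *m val A = 1%:M := congr1 val AA.
pose P := 2^-1 *: (1%:M - val A).
have PP : P *m P = P.
  rewrite /P -scalemxAl -scalemxAr scalerA mulmxBl mul1mx mulmxBr mulmx1 AA1.
  rewrite -(opprB 1%:M) opprK -mulr2n -[(1%:M - _) *+ _]scaler_nat scalerA.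
  by congr (_ *: _); field.
have rkP : \rank P = 1%N.
  (* The bound on the trace of [A] puts this strictly between 0 and 2, where the only integer is
     1. *)
  have : \tr P = 1 + (3 - \tr (val A)) / 2.
    by rewrite /P linearZ linearB /= mxtrace1; clear; lra.
  rewrite mxtrace_idempotent // => trP.
  move: trA; rewrite ltr_norml => /andP[t1 t2].
  have r0 : 0 < (\rank P)%:R :> R by move: trP t2; clear; lra.
  have r2 : (\rank P)%:R < 2 :> R by move: trP t1; clear; lra.
  by move: r0 r2; rewrite ltr0n ltr_nat; case: (\rank P) => [|[|]].
have [v PE] : exists v : 'rV_5, forall x, v *m x = 0 -> P *m x = 0.
  move: (col_base P) (row_base P) (mulmx_base P); rewrite rkP => c v PE.
  by exists v => x vx; rewrite -PE -mulmxA vx mulmx0.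
(* The vector representing the linear form [v] through [bform], so that $X^\perp$ is the kernel of
   [v], on which [P] vanishes and [A] is the identity. *)
pose X := sign_mx R *m v^T.
have XE x : bform X x = (v *m x) 0 0.
  by rewrite bform_mx trmx_mul trmxK tr_diag_mx -(mulmxA v) sign_mxK mulmx1.
have fixA x : P *m x = 0 -> val A *m x = x.
  rewrite -scalemxAl => /eqP; rewrite scaler_eq0 invr_eq0 pnatr_eq0 /=.
  by rewrite mulmxBl mul1mx subr_eq0 => /eqP.
have P0 : P != 0 by rewrite -mxrank_eq0 rkP.
exists X; apply: involution_reflects => // [||x Xx].
- apply/eqP => X0; case/negP: P0; apply/eqP/mulmx_cV_inj => x.
  rewrite mul0mx; apply: PE; rewrite (mx11_scalar (v *m x)) -XE X0.
  by rewrite bform0l raddf0.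
- by move=> A1; case/negP: P0; rewrite /P A1 subrr scaler0.
- by apply/fixA/PE; rewrite (mx11_scalar (v *m x)) -XE Xx raddf0.
Qed.

End Reflections.

(** * Orthogonal systems and the common null direction *)

Section OrthogonalFamilies.
Variable R : realType.

(** The family is a basis: pairing a linear relation with each non-null [v i] kills its coefficient,
    and [v k], which may be null, is then left alone and is non-zero. Non-degeneracy concludes. *)
Lemma orthogonal_family_total (v : 'I_5 -> 'cV[R]_5) (k : 'I_5) :
  (forall i j : 'I_5, (i < j)%N -> bform (v i) (v j) = 0) ->
  (forall i, i != k -> qform (v i) != 0) -> v k != 0 ->
  forall x, (forall i, bform (v i) x = 0) -> x = 0.
Proof.
move=> vlt vq vk x vx; have vv i j : i != j -> bform (v i) (v j) = 0.
  rewrite neq_ltn => /orP[/vlt //|/vlt vji].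
  by rewrite bformC.
pose V := \matrix_(i, j) v j i 0.
have VE (c : 'cV[R]_5) : V *m c = \sum_j c j 0 *: v j.
  apply/colP => i; rewrite mxE summxE; apply: eq_bigr => j _.
  by rewrite !mxE mulrC.
have Vfree (c : 'cV[R]_5) : V *m c = 0 -> c = 0.
  rewrite VE => c0; have ci i : i != k -> c i 0 = 0.
    move=> ik; have := bform_sumr (v i) (fun j => c j 0) v.
    rewrite c0 bform0r (bigD1 i) //= big1 ?addr0 -?qformE => [|j ji].
      by move/esym/eqP; rewrite mulf_eq0 (negPf (vq _ ik)) orbF => /eqP.
    by rewrite vv 1?eq_sym ?mulr0.
  apply/colP => i; rewrite mxE; have [->|/ci //] := eqVneq i k.
  move/eqP: c0; rewrite (bigD1 k) //= big1 ?addr0 => [|j /ci ->].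
    by rewrite scaler_eq0 (negPf vk) orbF => /eqP.
  by rewrite scale0r.
have Vunit : V \in unitmx.
  rewrite -unitmx_tr -row_free_unit; apply: inj_row_free => c cV.
  apply: trmx_inj; rewrite trmx0; apply/Vfree/trmx_inj.
  by rewrite trmx_mul trmxK trmx0.
apply: bform_nondegenerate => y.
rewrite -[y](mulKVmx Vunit) VE bform_sumr big1 // => i _.
by rewrite bformC vx mulr0.
Qed.

Lemma orthogonal_pairs_null (Y : cube_face -> 'cV[R]_5) :
  (forall s, qform (Y s) != 0) ->
  (forall s t, adjacent_faces s t -> bform (Y s) (Y t) = 0) ->
  (forall i c, Y (i, true) <> c *: Y (i, false)) ->
  exists p, [/\ p != 0, qform p = 0 & forall s, bform (Y s) p = 0].
Proof.
move=> Yq YY Ypair.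
(* Gram-Schmidt within each opposite pair; [w i] is non-zero because the two normals are not
   proportional. *)
pose a i := bform (Y (i, true)) (Y (i, false)) / qform (Y (i, false)).
pose w i := Y (i, true) - a i *: Y (i, false).
have w0 i : w i != 0 by rewrite subr_eq0; apply/eqP/Ypair.
have Yw i j : bform (Y (i, false)) (w j) = 0.
  rewrite bformBr bformZr; have [->|ij] := eqVneq i j.
    by rewrite -qformE divfK // bformC subrr.
  by rewrite !YY ?mulr0 ?subr0.
have Y1w i j : i != j -> bform (Y (i, true)) (w j) = 0.
  by move=> ij; rewrite bformBr bformZr !YY // mulr0 subrr.
have ww i j : i != j -> bform (w i) (w j) = 0.
  by move=> ij; rewrite bformBl bformZl Yw Y1w // mulr0 subrr.
pose i1 : 'I_3 := lift ord0 ord0; pose i2 : 'I_3 := ord_max.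
(* Otherwise four non-null vectors and [w i1], placed last since it may be null, form a total
   orthogonal family, and [w i2], orthogonal to all five, would vanish. *)
have qw : qform (w ord0) = 0.
  apply/eqP/negPn/negP => qw; case/negP: (w0 i2); apply/eqP.
  pose v (i : 'I_5) := nth 0
    [:: Y (ord0, false); Y (i1, false); Y (i2, false); w ord0; w i1] i.
  apply: (@orthogonal_family_total v ord_max) => //.
  - by case=> [[|[|[|[|[|i]]]]] ?] [[|[|[|[|[|j]]]]] ?] //= _;
      rewrite /v /= ?Yw ?ww ?YY.
  - by case=> [[|[|[|[|[|i]]]]] ?] //= _; rewrite /v /=.
  - by rewrite /v /=.
  - by case=> [[|[|[|[|[|i]]]]] ?] //=; rewrite /v /= ?Yw ?ww.
exists (w ord0); split=> // -[i []]; last exact: Yw.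
(* The remaining normal is [w ord0] plus a multiple of [Y (ord0, false)]; the first term is
   orthogonal to [w ord0] only because [w ord0] is null. *)
have [->|/Y1w //] := eqVneq i ord0.
rewrite -[Y _](subrK (a ord0 *: Y (ord0, false))) bformC bformDr bformZr.
by rewrite -qformE qw bformC Yw mulr0 addr0.
Qed.

(** The point is approached by $p+ty$ as $t\to0^+$, with $y\in X^\perp$, $q(y)=-1$ and, up to
    replacing $y$ by $-y$, $b(p,y)\le0$. Then $q(p+ty)=2t\,b(p,y)-t^2<0$, so the vector rescales
    into the hyperplane. *)
Lemma asymptotic_null (X : 'cV[R]_5) (p : nonzero_vec R) :
  qform (val p) = 0 -> bform X (val p) = 0 -> asymptotic (hyperplane X) (ray p).
Proof.
(* A neighbourhood of the ray is pulled back to an open set [V] of vectors containing [p]. *)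
move=> qp Xp U /pi_continuous [_ [[V Vop <-] Vp VU]].
have [y [Xy qy py]] :
    exists y, [/\ bform X y = 0, qform y = -1 & bform (val p) y <= 0].
  have [y Xy qy] := hyperplane_negative X.
  have [py|py] := leP (bform (val p) y) 0; first by exists y.
  exists (- y); rewrite !bformNr Xy oppr0 qformE bformNr.
  by rewrite bformC bformNr opprK -qformE oppr_le0 ltW.
have cvgp : (val p + t *: y) @[t --> (0 : R)^'+] --> val p.
  rewrite -[X in _ --> X]addr0 -[X in _ + X](scale0r y).
  apply: cvgD; first exact: cvg_cst.
  by apply: cvgZr_tmp; exact: cvg_at_right_filter.
have [t [t0 Vt]] : exists t : R, 0 < t /\ V (val p + t *: y).
  near (0 : R)^'+ => t; exists t; split => //.
  near: t; apply: cvgp; exact: open_nbhs_nbhs.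
set z := val p + t *: y in Vt.
have qz : qform z < 0.
  rewrite /z qformD qformZ bformZr qp qy; have := exprn_gt0 2 t0; nra.
have z0 : z \in nonzero_vec R.
  by apply/mem_set/eqP => z0; move: qz; rewrite z0 qformE bform0l ltxx.
have r0 : 0 < (Num.sqrt (- qform z))^-1 by rewrite invr_gt0 sqrtr_gt0 oppr_gt0.
(* [z] lies in [V] and [z'] in [AdS]; both span the same ray. *)
pose z' := (Num.sqrt (- qform z))^-1 *: z.
have z'0 : z' \in nonzero_vec R.
  apply/mem_set; rewrite /nonzero_vec/= scaler_eq0 negb_or gt_eqF //=.
  exact: set_mem z0.
exists (ray (SigSub z0)); split; last apply: VU.
exists (SigSub z'0).
  split; rewrite /AdS/= /z'.
    rewrite qformZ exprVn sqr_sqrtr ?oppr_ge0 ?ltW //.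
    by rewrite invrN mulNr mulVf // lt_eqF.
  by rewrite bformZr bformDr bformZr Xy Xp mulr0 addr0 mulr0.
apply/esym/eqmodP/asboolP; exists (Num.sqrt (- qform z))^-1 => //.
Unshelve. all: by end_near.
Qed.

End OrthogonalFamilies.

(** * Representations near the given one, and the dichotomy *)

Section Representations.
Variable R : realType.
Implicit Types rho : cube_hom R.

Lemma cube_gen_involution s : (cube_gen s * cube_gen s)%g = 1%g.
Proof.
by rewrite [LHS]cube_mul_pi; apply/eqP/cube_piP; exact: (CubeInvol [::] [::]).
Qed.

Lemma cube_gen_commute s t : adjacent_faces s t ->
  (cube_gen s * cube_gen t)%g = (cube_gen t * cube_gen s)%g.
Proof.
move=> st; rewrite [LHS]cube_mul_pi [RHS]cube_mul_pi; apply/eqP/cube_piP.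
exact: (CubeComm [::] [::]).
Qed.

Lemma cube_homM rho g h : (val rho) (g * h)%g = (val rho g * val rho h)%g.
Proof. by have /set_mem := valP rho; apply. Qed.

Lemma cube_hom1 rho : (val rho) 1%g = 1%g.
Proof. by apply: (@mulgI _ (val rho 1%g)); rewrite -cube_homM !mulg1. Qed.

Lemma on_gen_involution rho s : (on_gen rho s * on_gen rho s)%g = 1%g.
Proof. by rewrite /on_gen -cube_homM cube_gen_involution cube_hom1. Qed.

Lemma on_gen_commute rho s t : adjacent_faces s t ->
  (on_gen rho s * on_gen rho t)%g = (on_gen rho t * on_gen rho s)%g.
Proof. by move=> st; rewrite /on_gen -!cube_homM cube_gen_commute. Qed.

Lemma on_gen_entry_continuous s i j :
  continuous (fun rho => (val (on_gen rho s)) i j : R).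
Proof.
move=> rho.
apply: (@cvg_comp _ _ _ (fun rho => val (on_gen rho s))
  (fun M : 'M[R]_5 => M i j)); last exact: coord_continuous.
apply: (@cvg_comp _ _ _ (fun rho => on_gen rho s)
  (fun A : isom_ads R => val A)); last exact: initial_continuous.
apply: (@cvg_comp _ _ _ (fun rho => val rho)
  (fun f : {ptws cube_group -> isom_ads R} => f (cube_gen s))); last first.
  exact: (@proj_continuous _ (fun _ => isom_ads R) (cube_gen s)).
exact: initial_continuous.
Qed.

(** Some matrix entry differs, and by continuity its difference stays non-zero. *)
Lemma near_on_gen_neq rho s t : on_gen rho s <> on_gen rho t ->
  \forall rho' \near rho, on_gen rho' s <> on_gen rho' t.
Proof.
move=> st; have [i [j ij]] : exists i j,
    val (on_gen rho s) i j - val (on_gen rho t) i j != 0.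
  apply: contrapT => ij; apply/st/val_inj/matrixP => i j.
  by apply: contrapT => /eqP; rewrite -subr_eq0 => ?; apply: ij; exists i, j.
have cst : (fun rho' => val (on_gen rho' s) i j - val (on_gen rho' t) i j : R)
    @ rho --> val (on_gen rho s) i j - val (on_gen rho t) i j.
  exact: cvgB (@on_gen_entry_continuous s i j rho)
              (@on_gen_entry_continuous t i j rho).
have nz : \forall rho' \near rho,
    val (on_gen rho' s) i j - val (on_gen rho' t) i j != 0.
  exact: cvgr_neq0 cst ij.
apply: filterS nz => rho' /eqP + st'.
by rewrite st' subrr.
Qed.

Lemma near_on_gen_trace rho s : \tr (val (on_gen rho s)) = 3 ->
  \forall rho' \near rho, `|\tr (val (on_gen rho' s)) - 3| < 1.
Proof.
move=> tr3.
have ctr : (fun rho' => \tr (val (on_gen rho' s)) : R) @ rho --> (3 : R).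
  rewrite -tr3 /mxtrace; apply: cvg_big => [||i _].
  - exact: add_continuous.
  - exact: nbhs_filter.
  - exact: (@on_gen_entry_continuous s i i rho).
exact: cvgr_distC_lt ctr 1 ltr01.
Qed.

(** Injectivity turns commutation of adjacent generators into orthogonality, keeps opposite normals
    from being proportional, and makes the six hyperplanes distinct. The point at infinity then
    comes from [orthogonal_pairs_null]. *)
Lemma distinct_reflections_cusp rho :
  (forall s, exists X, reflects (val (on_gen rho s)) X) ->
  injective (on_gen rho) -> cusp_group rho.
Proof.
move=> /choice[Y rhoY] rho_inj.
have YY s t : adjacent_faces s t -> bform (Y s) (Y t) = 0.
  move=> st; apply: (reflects_commute (rhoY s) (rhoY t)).
    exact: on_gen_commute.
  by move=> /rho_inj E; move: st; rewrite /adjacent_faces E eqxx.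
have Ypair i c : Y (i, true) <> c *: Y (i, false).
  move=> E; suff : (i, true) = (i, false) by [].
  apply/rho_inj/val_inj/(reflects_inj (rhoY _) (rhoY _)).
  by exists c.
have [p [p_neq0 qp Yp]] :=
  orthogonal_pairs_null (fun s => (rhoY s).1) YY Ypair.
have p0 : p \in nonzero_vec R by exact/mem_set.
exists (fun s => hyperplane (Y s)), (ray (SigSub p0)).
have refl s := reflects_reflection (rhoY s).
split.
- by exists (SigSub p0).
- move=> s t st; apply: rho_inj; apply: (reflection_in_inj (refl s)).
  by rewrite st.
- by move=> s; split=> //; exact: asymptotic_null.
Qed.

(** A reflection determines its hyperplane. This makes the two alternatives of the theorem
    exclusive. *)
Lemma cusp_on_gen_inj rho : cusp_group rho -> injective (on_gen rho).
Proof.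
move=> [H [p [_ H_inj rhoH]]] s t st; apply: H_inj.
by apply: (reflection_in_hyperplane (rhoH s).1); rewrite st; exact: (rhoH t).1.
Qed.

(** [H] is injective away from [s2], so a coincidence must involve [s2], whose hyperplane is the
    spacelike one. *)
Lemma collapsed_on_gen_spacelike rho s t : collapsed_cusp_group rho ->
  s != t -> on_gen rho s = on_gen rho t ->
  exists2 H, spacelike H & reflection_in (on_gen rho s) H.
Proof.
move=> [H [p [_ rhoH [s1 [s2 [_ H12 H1 H_inj]]]]]] st Est.
have HE : H s = H t.
  apply: (reflection_in_hyperplane (rhoH s).1).
  by rewrite Est; exact: (rhoH t).1.
exists (H s); last exact: (rhoH s).1.
have [<-|s_s2] := eqVneq s2 s; first by rewrite -H12.
have [E|t_s2] := eqVneq s2 t; first by rewrite HE -E -H12.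
by case/eqP: st; apply: H_inj => //; rewrite inE eq_sym.
Qed.

Lemma cusp_or_collapsed_trace rho s :
  cusp_group rho \/ collapsed_cusp_group rho -> \tr (val (on_gen rho s)) = 3.
Proof.
move=> rho_cusp; have [H rhoH] : exists H, reflection_in (on_gen rho s) H.
  by case: rho_cusp => -[H [p [_]]]; [move=> _ /(_ s)[]|move=> /(_ s)[]];
    exists (H s).
have [[X X0 HX] _ _ _] := rhoH; rewrite HX in rhoH.
exact: reflects_trace (reflection_in_reflects X0 rhoH).
Qed.

End Representations.

Theorem proposition3p17 (R : realType) (rho : cube_hom R)
    (rho_cusp : cusp_group rho \/ collapsed_cusp_group rho) :
  \forall rho' \near rho,
    let collapses := exists s1 s2 : cube_face,
      [/\ s1 != s2, on_gen rho s1 = on_gen rho s2,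
          exists2 H, spacelike H & reflection_in (on_gen rho s1) H
        & on_gen rho' s1 = on_gen rho' s2] in
    (collapses /\ ~ cusp_group rho') \/ (~ collapses /\ cusp_group rho').
Proof.
have nbhs_rho : Filter (nbhs rho) by exact: nbhs_filter.
(* There are finitely many faces, and pairs of faces below, so finitely many neighbourhoods are
   intersected. *)
have near_tr : \forall rho' \near rho, forall s : 'I_3 * bool,
    `|\tr (val (on_gen rho' s)) - 3| < 1.
  apply: (filter_forall nbhs_rho) => s.
  exact/near_on_gen_trace/cusp_or_collapsed_trace.
have near_neq : \forall rho' \near rho,
    forall st : ('I_3 * bool) * ('I_3 * bool),
    on_gen rho st.1 <> on_gen rho st.2 -> on_gen rho' st.1 <> on_gen rho' st.2.
  apply: (filter_forall nbhs_rho) => -[s t] /=.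
  have [E|/near_on_gen_neq] := pselect (on_gen rho s = on_gen rho t).
    by apply: nearW.
  by apply: filterS.
apply: filterS2 near_tr near_neq => rho' tr_rho' neq_rho'.
set collapses := (X in (X /\ _) \/ _).
have [|not_collapses] := pselect collapses.
  move=> coll; left; split=> //.
  move: coll => [s1 [s2 [s12 _ _ E]]] /cusp_on_gen_inj/(_ _ _ E)/eqP.
  by rewrite (negPf s12).
right; split=> //; apply: distinct_reflections_cusp.
  by move=> s; apply: involution_near_reflection; [exact: on_gen_involution|].
move=> s t E; apply: contrapT => /eqP st; apply: not_collapses.
(* A coincidence under [rho'] already holds under [rho], which is therefore collapsed, with
   spacelike common hyperplane: this is alternative (1). *)
have Est : on_gen rho s = on_gen rho t.
  by apply: contrapT => /(neq_rho' (s, t)).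
exists s, t; split=> //.
case: rho_cusp => [/cusp_on_gen_inj/(_ _ _ Est)/eqP|].
  by rewrite (negPf st).
by move=> /collapsed_on_gen_spacelike; apply; [exact: st|].
Qed.
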